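(* The first-order theory $SAPP$ is complete.
   Context: Let $\mathcal{L}$ be the first-order language with a binary predicate symbol $O$ (meaning perpendicularity of lines) and equality $=$ (interpreted as true equality), without constants and function symbols. $SAPP$ is the theory in $\mathcal{L}$ consisting of the following formulas: $\lambda_{1n}$ (for each $n\ge 1$): $\forall y_1\ldots\forall y_n\forall s\,(O(s,y_1)\wedge\ldots\wedge O(s,y_n)\rightarrow\exists t\,(t\neq y_1\wedge\ldots\wedge t\neq y_n\wedge O(s,t)))$; $\lambda_{2n}$ (for each $n\ge 2$): $\forall y_1\ldots\forall y_n\exists s\,(\neg O(s,y_1)\wedge\ldots\wedge\neg O(s,y_n))$; $\lambda_3$: $\forall x\,\neg O(x,x)$; $\lambda_4$: $\forall x\forall y\,(O(x,y)\rightarrow O(y,x))$; $\lambda_5$: $\forall x\exists y\,O(x,y)$; $\lambda_6$: $\forall x\forall y\forall z\forall t\,(O(x,z)\wedge O(y,z)\wedge O(x,t)\rightarrow O(y,t))$. *)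

(* Defs.v *)
From mathcomp Require Import all_boot.

Set Implicit Arguments.
Unset Strict Implicit.
Unset Printing Implicit Defensive.

(* Formulas over a single binary predicate symbol and equality; individual
   variables are named by natural numbers. *)
Inductive form : Type :=
  | Eq of nat & nat
  | Perp of nat & nat
  | Not of form
  | And of form & form
  | Or of form & form
  | Imp of form & form
  | All of nat & form
  | Ex of nat & form.

Fixpoint free_vars (f : form) : seq nat :=
  match f with
  | Eq x y | Perp x y => [:: x; y]
  | Not g => free_vars g
  | And g h | Or g h | Imp g h => free_vars g ++ free_vars h
  | All x g | Ex x g => [seq z <- free_vars g | z != x]
  end.

Definition sentence (f : form) : Prop := free_vars f = [::].

Record structure : Type := Structure {
  dom :> Type;
  dom_inhabited : inhabited dom;
  perp : dom -> dom -> Prop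
}.

Definition update (A : Type) (v : nat -> A) (x : nat) (a : A) : nat -> A :=
  fun z => if z == x then a else v z.

Fixpoint sat (M : structure) (v : nat -> M) (f : form) : Prop :=
  match f with
  | Eq x y => v x = v y
  | Perp x y => perp (v x) (v y)
  | Not g => ~ sat v g
  | And g h => sat v g /\ sat v h
  | Or g h => sat v g \/ sat v h
  | Imp g h => sat v g -> sat v h
  | All x g => forall a : M, sat (update v x a) g
  | Ex x g => exists a : M, sat (update v x a) g
  end.

Definition holds (M : structure) (f : form) : Prop :=
  forall v : nat -> M, sat v f.

Definition theory : Type := form -> Prop.

Definition model (M : structure) (T : theory) : Prop :=
  forall f : form, T f -> holds M f.

Definition entails (T : theory) (f : form) : Prop :=
  forall M : structure, model M T -> holds M f.

Definition satisfiable (T : theory) : Prop :=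
  exists M : structure, model M T.

Definition complete (T : theory) : Prop :=
  satisfiable T /\
  forall f : form, sentence f -> entails T f \/ entails T (Not f).

(* The empty conjunction is a dummy; it does not occur in the axioms below. *)
Fixpoint conj (s : seq form) : form :=
  match s with
  | [::] => Eq 0 0
  | [:: f] => f
  | f :: s' => And f (conj s')
  end.

(* The bound variables y_1, ..., y_n are named 1, ..., n. *)
Definition ys (n : nat) : seq nat := iota 1 n.

Definition alls (xs : seq nat) (f : form) : form := foldr All f xs.

Definition lambda1 (n : nat) : form :=
  let s := 0 in let t := n.+1 in
  alls (ys n) (All s
    (Imp (conj [seq Perp s y | y <- ys n])
         (Ex t (conj (rcons [seq Not (Eq t y) | y <- ys n] (Perp s t)))))).

Definition lambda2 (n : nat) : form :=
  let s := 0 in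
  alls (ys n) (Ex s (conj [seq Not (Perp s y) | y <- ys n])).

Definition lambda3 : form := All 0 (Not (Perp 0 0)).

Definition lambda4 : form :=
  let x := 0 in let y := 1 in
  All x (All y (Imp (Perp x y) (Perp y x))).

Definition lambda5 : form :=
  let x := 0 in let y := 1 in
  All x (Ex y (Perp x y)).

Definition lambda6 : form :=
  let x := 0 in let y := 1 in let z := 2 in let t := 3 in
  All x (All y (All z (All t
    (Imp (And (Perp x z) (And (Perp y z) (Perp x t))) (Perp y t))))).

Inductive SAPP : theory :=
  | SAPP_lambda1 (n : nat) of 1 <= n : SAPP (lambda1 n)
  | SAPP_lambda2 (n : nat) of 2 <= n : SAPP (lambda2 n)
  | SAPP_lambda3 : SAPP lambda3
  | SAPP_lambda4 : SAPP lambda4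
  | SAPP_lambda5 : SAPP lambda5
  | SAPP_lambda6 : SAPP lambda6.

(* Main.v *)
Require Import Defs.
From mathcomp Require Import all_boot boolp.

Set Implicit Arguments.
Unset Strict Implicit.
Unset Printing Implicit Defensive.

(** Perpendicularity splits every model of the theory into infinitely many
    components, each a complete bipartite graph with two infinite sides: a
    class of parallel lines and the class of lines perpendicular to them
    ([perp_fresh], [generic_line]).  A finite configuration of lines in such
    a model is determined, as far as first-order logic can see, by which of
    its members are equal, perpendicular or parallel: if configurations in two
    models agree on these three relations, then any line added to the first
    can be answered by a line added to the second ([add_line]), so the two
    satisfy the same formulas ([sat_same_config]).  Parallelism must be
    recorded although it is not atomic, because two distinct lines that are
    not perpendicular may or may not have a common perpendicular.

    For a sentence the configuration is empty, so all models satisfy the same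
    sentences, and the theory is complete because it has a model
    ([grid_model]). *)

(** * Semantics of the axioms *)

Lemma holds_All (M : structure) x f : holds M (All x f) <-> holds M f.
Proof.
split=> [Mf v | Mf v a]; last exact: Mf.
suff <-: update v x (v x) = v by exact: Mf.
by apply: funext => z; rewrite /update; case: eqP => // ->.
Qed.

Lemma holds_alls (M : structure) xs f : holds M (alls xs f) <-> holds M f.
Proof. by elim: xs => //= x xs IH; rewrite holds_All. Qed.

Lemma sat_conj_rcons (M : structure) (v : nat -> M) F (xs : seq nat) g :
  sat v (conj (rcons [seq F y | y <- xs] g)) <->
  (forall y, y \in xs -> sat v (F y)) /\ sat v g.
Proof.
elim: xs => [|x xs IH]; first by split=> [|[]].
have -> : conj (rcons [seq F y | y <- x :: xs] g) =
          And (F x) (conj (rcons [seq F y | y <- xs] g)).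
  by rewrite /=; case: (rcons _ _) (size_rcons [seq F y | y <- xs] g).
split=> [[Fx /IH[Fxs ?]] | [Fxs ?]].
  by split=> // y /[!inE]/predU1P[->|/Fxs].
split; first by apply: Fxs; rewrite mem_head.
by apply/IH; split=> // y xs_y; apply: Fxs; rewrite inE xs_y orbT.
Qed.

Lemma sat_conj (M : structure) (v : nat -> M) F (xs : seq nat) :
  0 < size xs ->
  sat v (conj [seq F y | y <- xs]) <-> forall y, y \in xs -> sat v (F y).
Proof.
case/lastP: xs => // xs x _; rewrite map_rcons.
apply: iff_trans (sat_conj_rcons v F xs (F x)) _.
split=> [[Fxs Fx] y | Fxs].
  by rewrite mem_rcons inE => /predU1P[->|/Fxs].
by split=> [y xs_y|]; apply: Fxs; rewrite mem_rcons inE ?xs_y ?eqxx ?orbT.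
Qed.

Lemma leq_bigmax_in (F : nat -> nat) (xs : seq nat) j :
  j \in xs -> F j <= \max_(i <- xs) F i.
Proof. by move=> xs_j; apply: leq_bigmax_seq. Qed.

Lemma mem_ys n y : (y \in ys n) = (0 < y <= n).
Proof. by rewrite mem_iota. Qed.

Lemma holds_lambda1 (M : structure) n : 0 < n ->
  holds M (lambda1 n) <->
  forall (s : M) (u : nat -> M), (forall y, y \in ys n -> perp s (u y)) ->
  exists2 t, perp s t & forall y, y \in ys n -> t <> u y.
Proof.
move=> n_gt0; rewrite holds_alls holds_All.
have n1y y : y \in ys n -> (y == n.+1) = false.
  by rewrite mem_ys => /andP[_ le_yn]; rewrite ltn_eqF.
have y0 y : y \in ys n -> (y == 0) = false by rewrite mem_ys; case: y.
split=> [Mn s u su | Mn v].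
  have /= := Mn (fun y => if y == 0 then s else u y).
  case=> [|t /sat_conj_rcons[/= tu]].
    apply/sat_conj=> [|y ny /=]; first by rewrite size_iota.
    by rewrite y0 //; apply: su.
  rewrite /update /= eqxx => st; exists t => // y ny.
  by have := tu y ny; rewrite /= /update eqxx n1y // y0.
move=> /= /sat_conj sv; have [|t st tv] := Mn (v 0) v.
  by apply: sv; rewrite size_iota.
exists t; apply/sat_conj_rcons; rewrite /= /update /= eqxx; split=> // y ny.
by rewrite n1y //; apply: tv.
Qed.

Lemma holds_lambda2 (M : structure) n : 0 < n ->
  holds M (lambda2 n) <->
  forall u : nat -> M, exists s, forall y, y \in ys n -> ~ perp s (u y).
Proof.
move=> n_gt0; rewrite holds_alls.
have y0 y : y \in ys n -> (y == 0) = false by rewrite mem_ys; case: y.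
split=> Mn u; have [s us] := Mn u; exists s.
  move/sat_conj: us; rewrite size_iota => /(_ n_gt0) us y ny.
  by have := us y ny; rewrite /= /update /= y0.
apply/sat_conj=> [|y ny]; first by rewrite size_iota.
by rewrite /= /update /= y0 //; apply: us.
Qed.

(** * The geometry of a model *)

Definition par (M : structure) (x y : M) : Prop :=
  exists2 z, perp x z & perp y z.

Section Geometry.

Context (M : structure) (MS : model M SAPP).
Implicit Types x y z s t : M.

Lemma perp_irr x : ~ perp x x.
Proof. exact: (MS SAPP_lambda3 (fun=> x) x). Qed.

Lemma perp_sym x y : perp x y -> perp y x.
Proof. exact: (MS SAPP_lambda4 (fun=> x) x y). Qed.

Lemma perp_ex x : exists y, perp x y.
Proof. exact: (MS SAPP_lambda5 (fun=> x) x). Qed.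

Lemma par_perp x y z : par x y -> perp x z -> perp y z.
Proof.
by case=> t xt yt xz; apply: (MS SAPP_lambda6 (fun=> x) x y t z).
Qed.

Lemma par_refl x : par x x.
Proof. by have [y xy] := perp_ex x; exists y. Qed.

Lemma par_sym x y : par x y -> par y x.
Proof. by case=> z xz yz; exists z. Qed.

Lemma par_trans y x z : par x y -> par y z -> par x z.
Proof.
by move=> xy [t yt zt]; exists t => //; apply: par_perp (par_sym xy) yt.
Qed.

Lemma perp_par x y z : perp x y -> perp y z <-> par x z.
Proof.
move=> xy; split=> [yz | xz]; first by exists y => //; apply: perp_sym.
by apply/perp_sym/(par_perp xz).
Qed.

(** The axioms only give a new line in a set of lines already perpendicular to
    [s]; lines of the list that are not perpendicular to [s] cannot coincide
    with the new one and are replaced by an arbitrary perpendicular. *)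
Lemma perp_fresh s (xs : seq nat) (w : nat -> M) :
  exists2 t, perp s t & forall j, j \in xs -> t <> w j.
Proof.
have [p sp] := perp_ex s; pose n := (\max_(j <- xs) j).+1.
pose u i := if `[< perp s (w i.-1) >] then w i.-1 else p.
have n_gt0 : 0 < n by [].
have Mn := (holds_lambda1 M n_gt0).1 (MS (SAPP_lambda1 n_gt0)).
have [y _ | t st tu] := Mn s u; first by rewrite /u; case: asboolP.
exists t => // j xs_j tw; apply: (tu j.+1).
  by rewrite mem_ys /n /= ltnS; apply: (leq_bigmax_in id).
by rewrite /u /= -tw; case: asboolP.
Qed.

(** A component is excluded by avoiding the perpendiculars of one line on each
    of its two sides. *)
Lemma generic_line (xs : seq nat) (w : nat -> M) :
  exists t, forall j, j \in xs -> ~ perp t (w j) /\ ~ par t (w j).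
Proof.
have [p wp] := choice (fun j => perp_ex (w j)).
pose n := (\max_(j <- xs) j).+1.*2.
(* even offsets carry the given lines, odd ones their perpendiculars *)
pose u i := if odd i.-1 then p i.-1./2 else w i.-1./2.
have n_gt1 : 1 < n by rewrite /n doubleS.
have Mn := (holds_lambda2 M (ltnW n_gt1)).1 (MS (SAPP_lambda2 n_gt1)).
have [t tu] := Mn u; exists t => j xs_j.
have le_j : j <= \max_(j <- xs) j by apply: (leq_bigmax_in id).
split=> [tw | tw].
  apply: (tu j.*2.+1); last by rewrite /u /= odd_double doubleK.
  by rewrite mem_ys /n doubleS /= ltnS leqW // leq_double.
apply: (tu j.*2.+2).
  by rewrite mem_ys /n doubleS /= !ltnS leq_double.
by rewrite /u /= odd_double uphalf_double; apply: par_perp (par_sym tw) (wp j).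
Qed.

End Geometry.

(** * Back and forth *)

Definition same_rels (M N : structure) (a c : M) (b d : N) : Prop :=
  [/\ a = c <-> b = d, perp a c <-> perp b d & par a c <-> par b d].

Definition same_config (M N : structure) (xs : seq nat)
    (v : nat -> M) (w : nat -> N) : Prop :=
  {in xs &, forall i j, same_rels (v i) (v j) (w i) (w j)}.

Lemma same_config_sym (M N : structure) xs (v : nat -> M) (w : nat -> N) :
  same_config xs v w -> same_config xs w v.
Proof.
by move=> vw i j xi xj; have [] := vw i j xi xj; split; apply: iff_sym.
Qed.

Lemma same_config_sub (M N : structure) xs zs (v : nat -> M) (w : nat -> N) :
  {subset zs <= xs} -> same_config xs v w -> same_config zs v w.
Proof. by move=> sub vw i j /sub xi /sub xj; apply: vw. Qed.

Section BackAndForth.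

Context (M N : structure) (MS : model M SAPP) (NS : model N SAPP).

Lemma same_rels_refl (a : M) (b : N) : same_rels a a b b.
Proof.
split; first by [].
  by split=> [/(perp_irr MS) | /(perp_irr NS)].
by split=> _; apply: par_refl.
Qed.

Lemma same_rels_sym (a c : M) (b d : N) :
  same_rels a c b d -> same_rels c a d b.
Proof.
case=> eq_ac perp_ac par_ac; split.
- by split=> /esym/eq_ac/esym.
- by split=> [/(perp_sym MS)/perp_ac | /(perp_sym NS)/perp_ac]; apply: perp_sym.
by split=> /par_sym/par_ac/par_sym.
Qed.

(** The line [a] is in the configuration, or parallel to one of its lines, or
    perpendicular to one, or in a component that the configuration does not
    meet.  In the two middle cases that one line fixes how [a] relates to all
    the others, so any new line in the corresponding class answers it. *)
Lemma add_line xs (v : nat -> M) (w : nat -> N) (a : M) :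
  same_config xs v w ->
  exists b, forall j, j \in xs -> same_rels a (v j) b (w j).
Proof.
move=> vw.
have [[i xs_i ->] | a_new] := EM (exists2 i, i \in xs & a = v i).
  by exists (w i) => j xs_j; apply: vw.
have eqF j (b : N) : j \in xs -> b <> w j -> a = v j <-> b = w j.
  by move=> xs_j bw; split=> // av; case: a_new; exists j.
have [[i xs_i va] | no_par] := EM (exists2 i, i \in xs & par (v i) a).
  have [p wp] := perp_ex NS (w i).
  have [b pb b_new] := perp_fresh NS p xs w; exists b => j xs_j.
  have wb : par (w i) b by exists p => //; apply: perp_sym.
  have [_ perp_ij par_ij] := vw i j xs_i xs_j; split.
  - by apply: eqF => //; apply: b_new.
  - split=> [/(par_perp MS (par_sym va))/perp_ij | ].
      exact: par_perp.
    by move/(par_perp NS (par_sym wb))/perp_ij; apply: par_perp.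
  split=> [/(par_trans MS va)/par_ij | /(par_trans NS wb)/par_ij].
    by apply: par_trans => //; apply: par_sym.
  by apply: par_trans => //; apply: par_sym.
have [[i xs_i va] | no_perp] := EM (exists2 i, i \in xs & perp (v i) a).
  have [b wb b_new] := perp_fresh NS (w i) xs w; exists b => j xs_j.
  have [_ perp_ij par_ij] := vw i j xs_i xs_j; split.
  - by apply: eqF => //; apply: b_new.
  - by rewrite (perp_par MS _ va) (perp_par NS _ wb).
  rewrite -(perp_par MS _ (perp_sym MS va)) perp_ij.
  by rewrite (perp_par NS _ (perp_sym NS wb)).
have [b b_new] := generic_line NS xs w; exists b => j xs_j.
have [not_perp not_par] := b_new j xs_j; split.
- apply: eqF => // b_eq; apply: not_par; rewrite b_eq; exact: par_refl.
- by split=> // av; case: no_perp; exists j => //; apply: perp_sym.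
by split=> // av; case: no_par; exists j => //; apply: par_sym.
Qed.

Lemma same_config_update x xs (v : nat -> M) (w : nat -> N) (a : M) :
  same_config [seq z <- xs | z != x] v w ->
  exists b, same_config xs (update v x a) (update w x b).
Proof.
move=> vw; have [b ab] := add_line a vw; exists b => i j xs_i xs_j.
rewrite /update; have [_ | ix] := eqVneq i x; have [_ | jx] := eqVneq j x.
- exact: same_rels_refl.
- by apply: ab; rewrite mem_filter jx.
- by apply/same_rels_sym/ab; rewrite mem_filter ix.
by apply: vw; rewrite mem_filter ?ix ?jx.
Qed.

End BackAndForth.

Lemma sat_same_config (M N : structure) f (v : nat -> M) (w : nat -> N) :
  model M SAPP -> model N SAPP ->
  same_config (free_vars f) v w -> sat v f <-> sat w f.
Proof.
move=> MS NS; elim: f v w => /=.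
- by move=> x y v w vw; have [] := vw x y; rewrite ?inE ?eqxx ?orbT.
- by move=> x y v w vw; have [] := vw x y; rewrite ?inE ?eqxx ?orbT.
- by move=> f IH v w /IH ->.
1-3: move=> f IHf g IHg v w vw;
  rewrite (IHf v w) ?(IHg v w) //;
  by apply: same_config_sub vw => z; rewrite mem_cat => ->; rewrite ?orbT.
- move=> x f IH v w vw; split=> sat_f => [b | a].
    have [a ab] := same_config_update NS MS b (same_config_sym vw).
    exact/(IH _ _ (same_config_sym ab)).
  have [b ab] := same_config_update MS NS a vw.
  exact/(IH _ _ ab).
move=> x f IH v w vw; split=> [[a sat_a] | [b sat_b]].
  have [b ab] := same_config_update MS NS a vw.
  by exists b; apply/(IH _ _ ab).
have [a ab] := same_config_update NS MS b (same_config_sym vw).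
by exists a; apply/(IH _ _ (same_config_sym ab)).
Qed.

(** * Existence of a model *)

(** The countable model: a line is given by its component, its side of that
    component and its index there. *)
Definition grid : structure :=
  @Structure (nat * bool * nat) (inhabits (0, true, 0))
    (fun x y => x.1.1 = y.1.1 /\ x.1.2 <> y.1.2).

Lemma grid_model : model grid SAPP.
Proof.
move=> _ [n n_gt0 | n n_gt1 | | | | ].
- apply/holds_lambda1 => // s u _.
  pose k := (\max_(y <- ys n) (u y).2).+1.
  exists (s.1.1, ~~ s.1.2, k) => [|y ny tu].
    by split=> //=; case: s.1.2.
  by have := leq_bigmax_in (fun y => (u y).2) ny; rewrite -tu /= ltnn.
- apply/holds_lambda2 => [|u]; first exact: ltnW.
  pose c := (\max_(y <- ys n) (u y).1.1).+1.
  exists (c, true, 0) => y ny [/= cu _].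
  by have := leq_bigmax_in (fun y => (u y).1.1) ny; rewrite -cu ltnn.
- by move=> v a [].
- by move=> v /= a b [ab side]; split; [apply: esym | apply: nesym].
- by move=> v /= a; exists (a.1.1, ~~ a.1.2, 0); split=> //=; case: a.1.2.
move=> v /= [[ca da] ka] [[cb db] kb] [[cz dz] kz] [[ct dt] kt].
rewrite /update /= => -[[-> az] [[-> bz] [<- at_]]]; split=> //.
by case: da db dz dt az bz at_ => [] [] [] [].
Qed.

Theorem corollary2p10 : complete SAPP.
Proof.
split; first by exists grid; apply: grid_model.
move=> f closed_f; pose v0 (_ : nat) : grid := (0, true, 0).
have transfer (M : structure) (v : nat -> M) :
    model M SAPP -> sat v f <-> sat v0 f.
  move=> MS; apply: sat_same_config => //; first exact: grid_model.
  by rewrite closed_f.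
have [sat_f | unsat_f] := EM (sat v0 f); [left | right] => M MS v.
  exact/(transfer M v MS).
by move=> /= /(transfer M v MS).
Qed.
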